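(* Let $\mathcal{X}=(\mathcal{V},\varrho,\upsilon)$ be a fuzzy cycle with $n$ vertices. If $\mathcal{X}$ is $\beta$-saturated and the weight of the $\beta$-edges is $w$, then $$SDI(\mathcal{X})=n\left\lceil\frac{n}{3}\right\rceil w.$$
   Context: A fuzzy graph $\mathcal{X}=(\mathcal{V},\varrho,\upsilon)$ consists of a nonempty finite set $\mathcal{V}$ of vertices, a function $\varrho:\mathcal{V}\to[0,1]$ and a symmetric function $\upsilon:\mathcal{V}\times\mathcal{V}\to[0,1]$ with $\upsilon(ab)\le\min(\varrho(a),\varrho(b))$ for all $a,b$, and no loops ($\upsilon(aa)=0$). Put $\varrho^*=\{a:\varrho(a)>0\}$ and $\upsilon^*=\{ab:\upsilon(ab)>0\}$; it is assumed that $\mathcal{V}=\varrho^*$, and the elements of $\upsilon^*$ are called edges. A path is a sequence of distinct vertices $a_1,\dots,a_m$ with $\upsilon(a_ia_{i+1})>0$ for all $i<m$; its strength is the minimum of the weights $\upsilon$ of its edges. The strength of connectedness between $a$ and $b$ is the maximum of the strengths of all paths from $a$ to $b$ (and $0$ if there is none). For an edge $ab$ let $\upsilon'^\infty(a,b)$ be the strength of connectedness between $a$ and $b$ after deleting the edge $ab$. The edge $ab$ is an $\alpha$-edge if $\upsilon(ab)>\upsilon'^\infty(a,b)$, a $\beta$-edge if $\upsilon(ab)=\upsilon'^\infty(a,b)$; it is strong if it is an $\alpha$- or $\beta$-edge. $\mathcal{X}$ is a fuzzy cycle if its underlying graph $(\varrho^*,\upsilon^* )$ is a cycle and at least two edges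 have the least edge weight. (In a fuzzy cycle all $\beta$-edges have equal weight.) A fuzzy cycle is $\beta$-saturated if every vertex is incident with at least one $\beta$-edge. A set $\mathcal{D}\subseteq\mathcal{V}$ is a strong dominating set (SDS) if every $b\in\mathcal{V}\setminus\mathcal{D}$ is joined by a strong edge to some $a\in\mathcal{D}$. An SDS $\mathcal{D}$ is a minimal strong dominating set (MSDS) if $\mathcal{D}\setminus\{a\}$ is not an SDS for every $a\in\mathcal{D}$. The weight of $\mathcal{S}\subseteq\mathcal{V}$ is $W(\mathcal{S})=\sum_{a\in\mathcal{S}}\min\{\upsilon(ab): ab \text{ is a strong edge}\}$. The strong domination degree ${}_{sd}d(u)$ of a vertex $u$ is the minimum of the weights of the MSDSs containing $u$; the strong domination index is $SDI(\mathcal{X})=\sum_{v\in\mathcal{V}}{}_{sd}d(v)$. *)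

(* Defs.v *)
From HB Require Import structures.
From mathcomp Require Import all_boot all_order all_algebra.
From mathcomp Require Import reals.

Set Implicit Arguments.
Unset Strict Implicit.
Unset Printing Implicit Defensive.
Import Order.TTheory GRing.Theory Num.Theory.
Local Open Scope ring_scope.

Record fuzzyGraph (R : realType) (V : finType) := FuzzyGraph {
  vweight : V -> R;
  eweight : V -> V -> R;
  fg_nonempty : (0 < #|V|)%N;
  vweight_range : forall a, 0 <= vweight a <= 1;
  eweight_range : forall a b, 0 <= eweight a b <= 1;
  eweight_sym : forall a b, eweight a b = eweight b a;
  eweight_le : forall a b, eweight a b <= Num.min (vweight a) (vweight b);
  eweight_loop : forall a, eweight a a = 0;
  vweight_gt0 : forall a, 0 < vweight a
}.

Section Connectedness.
Variables (R : realType) (V : finType) (u : V -> V -> R).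

(* The path a_1, ..., a_m is represented by its head a_1 and its tail
   [:: a_2; ...; a_m]. *)
Definition fpath_from_to (a b : V) (p : seq V) : bool :=
  [&& uniq (a :: p), path (fun x y => 0 < u x y) a p & last a p == b].

(* Edge weights are at most 1, so the base value 1 is neutral; it is the
   strength of the edgeless path only. *)
Definition strength (a : V) (p : seq V) : R :=
  \big[Num.min/1]_(x <- pairmap u a p) x.

(* Vertices of a path are distinct, so the tail of any path has size at most
   #|V|; the base value 0 is the strength when there is no path. *)
Definition connectedness (a b : V) : R :=
  \big[Num.max/0]_(p : #|V|.-bseq V | fpath_from_to a b p) strength a p.

Definition delete_edge (a b x y : V) : R :=
  if [set x; y] == [set a; b] then 0 else u x y.

End Connectedness.

Section FuzzyGraphs.
Variables (R : realType) (V : finType) (X : fuzzyGraph R V).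
Local Notation ups := (eweight X).

Definition edge : rel V := fun a b => 0 < ups a b.

Definition connectedness_del (a b : V) : R :=
  connectedness (delete_edge ups a b) a b.

Definition alpha_edge : rel V :=
  fun a b => edge a b && (connectedness_del a b < ups a b).

Definition beta_edge : rel V :=
  fun a b => edge a b && (ups a b == connectedness_del a b).

Definition strong_edge : rel V := fun a b => alpha_edge a b || beta_edge a b.

Definition least_edge (a b : V) : Prop :=
  edge a b /\ forall x y, edge x y -> ups a b <= ups x y.

Definition strong_dominating (D : {set V}) : bool :=
  [forall b, (b \notin D) ==> [exists a in D, strong_edge a b]].

Definition minimal_strong_dominating (D : {set V}) : bool :=
  strong_dominating D && [forall a in D, ~~ strong_dominating (D :\ a)].

(* Edge weights are at most 1, so the base value 1 is neutral; it is reached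
   without an edge only at a vertex incident with no strong edge, where the
   minimum is undefined. *)
Definition min_strong_weight (a : V) : R :=
  \big[Num.min/1]_(b | strong_edge a b) ups a b.

Definition weight (S : {set V}) : R := \sum_(a in S) min_strong_weight a.

(* The base value is neutral, since no subset weighs more than [set: V]. *)
Definition sd_degree (u : V) : R :=
  \big[Num.min/weight [set: V]]_(D : {set V} |
     minimal_strong_dominating D && (u \in D)) weight D.

Definition SDI : R := \sum_(v : V) sd_degree v.

End FuzzyGraphs.

(* The vertices can be arranged in a cyclic sequence of length at least 3 in
   which the adjacent pairs are exactly the cyclically consecutive ones. *)
Definition cycle_graph (V : finType) (e : rel V) : Prop :=
  exists c : seq V,
    [/\ uniq c, (3 <= size c)%N, forall x, x \in c &
        forall a b, e a b = (b == next c a) || (a == next c b)].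

Definition fuzzy_cycle (R : realType) (V : finType) (X : fuzzyGraph R V) :
    Prop :=
  cycle_graph (edge X) /\
  exists a b c d : V,
    [/\ least_edge X a b, least_edge X c d & [set a; b] != [set c; d]].

Definition beta_saturated (R : realType) (V : finType) (X : fuzzyGraph R V) :
    Prop :=
  forall a, exists b, beta_edge X a b.

(* Main.v *)
Require Import Defs.
From mathcomp Require Import all_boot all_order all_algebra.
From mathcomp Require Import reals.
From mathcomp Require Import zify lra.

Set Implicit Arguments.
Unset Strict Implicit.
Unset Printing Implicit Defensive.
Import Order.TTheory GRing.Theory Num.Theory.
Local Open Scope ring_scope.

(* Deleting an edge ab of the cycle leaves a single path from a to b.  It runs
   through an edge of least weight, since at least two edges have least weight.
   Hence every edge is strong and every beta-edge has the least weight w, so by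
   saturation every vertex has minimal strong weight w and an MSDS D weighs
   |D| w.  A vertex dominates at most three vertices, so |D| >= n / 3; every
   third vertex starting from u gives a strong dominating set that attains this
   bound, hence is minimal. *)

(** * Labelling a cycle by positions *)

Definition cyclic_adj (n : nat) : rel nat := fun i j =>
  [|| i.+1 == j, j.+1 == i, (i == 0%N) && (j.+1 == n) |
      (j == 0%N) && (i.+1 == n)].

(** An isomorphism onto the cycle on 0, ..., [#|V|.-1]. Positions are plain naturals, so that
    questions of adjacency reduce to linear arithmetic. *)
Definition cyclic_labelling (V : finType) (e : rel V) (pos : V -> nat) : Prop :=
  [/\ injective pos, forall v, (pos v < #|V|)%N,
      forall i, (i < #|V|)%N -> exists v, pos v = i &
      forall a b, e a b = cyclic_adj #|V| (pos a) (pos b)].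

Lemma index_next (T : eqType) (c : seq T) (x : T) :
  uniq c -> x \in c ->
  index (next c x) c =
    if (index x c).+1 == size c then 0%N else (index x c).+1.
Proof.
case: c => // y c uc xc; rewrite next_nth xc.
move: (xc); rewrite -index_mem; set i := index x (y :: c) => lti.
case: eqP => [eqi|nei].
  by rewrite nth_default ?index_head //; move: eqi => /=; lia.
have lt2 : (i.+1 < size (y :: c))%N by lia.
by rewrite -[nth y c i]/(nth y (y :: c) i.+1) index_uniq.
Qed.

(** The free choice of [r] later lets the dominating set start at a prescribed vertex. *)
Lemma cycle_graph_labelling (V : finType) (e : rel V) (r : V) :
  cycle_graph e -> exists2 pos, cyclic_labelling e pos & pos r = 0%N.
Proof.
move=> [c0 [uc0 _ allc0 e0]].
have [k c def_c] := rot_to (allc0 r).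
have uc : uniq (r :: c) by rewrite -def_c rot_uniq.
have allc x : x \in r :: c by rewrite -def_c mem_rot.
have card_c : size (r :: c) = #|V|.
  by rewrite -(card_uniqP uc); apply: eq_card => x; rewrite allc.
exists (index^~ (r :: c)); last exact: index_head.
have inj : injective (index^~ (r :: c)).
  by move=> x y /index_inj; apply.
split=> //.
- by move=> v; rewrite -card_c index_mem.
- by move=> i lti; exists (nth r (r :: c) i); rewrite index_uniq ?card_c.
move=> a b; rewrite e0 -!(next_rot k uc0) def_c -!(inj_eq inj).
rewrite !index_next // card_c.
have := index_mem a (r :: c); have := index_mem b (r :: c).
rewrite !allc card_c.
move: (index a _) (index b _) => i j; rewrite /cyclic_adj => ltj lti.
case: (i.+1 =P _) => ?; case: (j.+1 =P _) => ?; apply/idP/idP; lia.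
Qed.

Lemma cycle_graph_card (V : finType) (e : rel V) :
  cycle_graph e -> (3 <= #|V|)%N.
Proof.
move=> [c [uc c3 allc _]]; rewrite (leq_trans c3) // -(card_uniqP uc).
exact: max_card.
Qed.

(** * Edges and cuts of a labelled cycle *)

Definition same_pair (i j k l : nat) : bool :=
  (i == k) && (j == l) || (i == l) && (j == k).

Lemma same_pairP {V : finType} {pos : V -> nat} {p q s t : V} :
  injective pos ->
  reflect ([set p; q] = [set s; t]) (same_pair (pos p) (pos q) (pos s) (pos t)).
Proof.
move=> inj; rewrite /same_pair !(inj_eq inj); apply: (iffP idP).
  by case/orP=> /andP[/eqP-> /eqP->]; rewrite // setUC.
move/setP=> E; move: (E p) (E q) (E s) (E t).
rewrite !inE !eqxx ?orbT /= => /esym.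
by rewrite (eq_sym s p) (eq_sym s q) (eq_sym t p) (eq_sym t q);
  do 4 case: eqP => ?; subst; rewrite ?eqxx.
Qed.

(** The edge between [k] and [k.+1] has position [k]; the closing edge between [n.-1] and 0 has
    position [n.-1]. *)
Definition edge_pos (n i j : nat) : nat :=
  if i.+1 == j then i else if j.+1 == i then j else n.-1.

Lemma edge_pos_inj (n i j k l : nat) :
  (3 <= n)%N -> cyclic_adj n i j -> cyclic_adj n k l ->
  (i < n)%N -> (j < n)%N -> (k < n)%N -> (l < n)%N ->
  (edge_pos n i j == edge_pos n k l) = same_pair i j k l.
Proof.
move=> n3; rewrite /cyclic_adj /edge_pos /same_pair => ij kl ? ? ? ?.
by case: (i.+1 =P j) => ?; case: (j.+1 =P i) => ?;
  case: (k.+1 =P l) => ?; case: (l.+1 =P k) => ?; apply/eqP/idP; lia.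
Qed.

(** An edge at position [k < n.-1] joins [k] to [k.+1] and crosses the cut after [m] only for
    [m = k]. The closing edge crosses every cut except the trivial one at [m = n.-1], where the two
    terms on the right cancel. *)
Lemma cut_crossing (n m i j : nat) :
  (3 <= n)%N -> cyclic_adj n i j -> (i < n)%N -> (j < n)%N -> (m < n)%N ->
  (i <= m)%N (+) (j <= m)%N =
    (edge_pos n i j == m) (+) (edge_pos n i j == n.-1).
Proof.
move=> n3; rewrite /cyclic_adj /edge_pos => ij ? ? ?.
by case: (i.+1 =P j) => ?; case: (j.+1 =P i) => ?;
  do 2 case: eqP => ?; do 2 case: leqP => ? //=; lia.
Qed.

(* The cycle without two edges is disconnected: the sum mod 2 of the cuts after
   their positions is crossed by these two edges only, because the closing edge
   crosses every cut but the trivial one after its own position [n.-1]. *)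
Lemma cycle_graph_cut {V : finType} {e : rel V} {a b x y : V} :
  cycle_graph e -> e a b -> e x y -> [set x; y] != [set a; b] ->
  exists S : pred V, S a != S b /\
    forall p q, e p q -> S p != S q ->
      [set p; q] = [set a; b] \/ [set p; q] = [set x; y].
Proof.
move=> ce; have n3 := cycle_graph_card ce.
have [pos [inj ltn _ epos] _] := cycle_graph_labelling a ce.
pose ep p q := edge_pos #|V| (pos p) (pos q).
have epP p q s t : e p q -> e s t ->
    reflect ([set p; q] = [set s; t]) (ep p q == ep s t).
  by rewrite !epos => pq st; rewrite edge_pos_inj //; apply: same_pairP.
have lt_ep p q : (ep p q < #|V|)%N.
  have := ltn p; have := ltn q; rewrite /ep /edge_pos.
  by case: ifP => [|_]; last case: ifP; lia.
move=> ab xy nxy.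
pose S v := (pos v <= ep a b)%N (+) (pos v <= ep x y)%N.
have SE p q : e p q -> (S p != S q) = (ep p q == ep a b) (+) (ep p q == ep x y).
  move=> pq; rewrite negb_eqb /S addbACA !(@cut_crossing #|V|) -?epos //.
  by rewrite addbACA addbb addbF.
exists S; split=> [|p q pq].
  by rewrite SE // eqxx; apply/epP => // E; rewrite E eqxx in nxy.
rewrite SE //; case: (epP p q a b) => // [? _|_ /= /epP ?]; first by left.
by right; auto.
Qed.

(** With the weight function as [f], the crossing step contributes to the list whose minimum is the
    strength of the path. *)
Lemma path_crossing {V T : eqType} {e : rel V} {S : pred V} {a : V} {p : seq V}
    (f : V -> V -> T) :
  path e a p -> S a != S (last a p) ->
  exists x y, [/\ e x y, S x != S y & f x y \in pairmap f a p].
Proof.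
elim: p a => [|b p IHp] a /=; first by rewrite eqxx.
case/andP=> eab ebp; have [Sab|Sab] := eqVneq (S a) (S b); last first.
  by exists a, b; rewrite mem_head.
rewrite Sab => /(IHp _ ebp)[x [y [exy Sxy fxy]]].
by exists x, y; rewrite in_cons fxy orbT.
Qed.

(** * Strong edges of a fuzzy cycle *)

Section FuzzyCycle.
Variables (R : realType) (V : finType) (X : fuzzyGraph R V).
Hypothesis cycleX : fuzzy_cycle X.

Lemma eweight_set2 (p q x y : V) :
  [set p; q] = [set x; y] -> eweight X p q = eweight X x y.
Proof.
move/setP=> E; move: (E p) (E q) (E x) (E y); rewrite !inE !eqxx ?orbT /=.
move=> /esym/orP[]/eqP-> /esym/orP[]/eqP->; rewrite ?eqxx ?orbb //.
- by move=> _ /eqP->.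
- by rewrite eweight_sym.
- by move=> /eqP->.
Qed.

Lemma least_edge_weight (a b x y : V) :
  least_edge X a b -> least_edge X x y -> eweight X a b = eweight X x y.
Proof.
move=> [ab minab] [xy minxy]; apply: le_anti.
by rewrite minab // minxy.
Qed.

Lemma connectedness_del_le (a b x y : V) :
  edge X a b -> least_edge X x y ->
  connectedness_del X a b <= eweight X x y.
Proof.
move=> ab xy; have [cX [x1 [y1 [x2 [y2 [xy1 xy2 ne12]]]]]] := cycleX.
(* At most one of the two least edges is [ab]; the other one serves. *)
wlog nab : x1 y1 x2 y2 xy1 xy2 ne12 / [set x1; y1] != [set a; b].
  move=> IH; have [ab1|] := eqVneq [set x1; y1] [set a; b]; last exact: IH ne12.
  by apply: (IH x2 y2 x1 y1); rewrite 1?eq_sym // -ab1.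
rewrite (least_edge_weight xy xy1) => {x y xy}.
have [S [Sab cutS]] := cycle_graph_cut cX ab (proj1 xy1) nab.
apply: bigmax_le => [|p]; first by have /andP[] := eweight_range X x1 y1.
case/and3P=> _ pathp /eqP lastp.
rewrite -lastp in Sab.
have [p1 [q1 [pq Spq pqp]]] :=
  path_crossing (delete_edge (eweight X) a b) pathp Sab.
(* The deleted edge has weight 0 and cannot be a step of the path, so the crossing edge is the least
   edge [x1 y1]. *)
move: pq pqp; rewrite /delete_edge; case: eqP => [|nepq pq pqp].
  by rewrite ltxx.
have [//|pqxy] := cutS _ _ pq Spq.
by rewrite -(eweight_set2 pqxy); apply: ge_bigmin_seq.
Qed.

Lemma strong_edgeE (a b : V) : strong_edge X a b = edge X a b.
Proof.
rewrite /strong_edge /alpha_edge /beta_edge -andb_orr.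
case ab : (edge X a b) => //=.
have [_ [x [y [_ [_ [xy _ _]]]]]] := cycleX.
rewrite orbC eq_sym -le_eqVlt.
exact: le_trans (connectedness_del_le ab xy) (proj2 xy _ _ ab).
Qed.

Lemma beta_edge_least (a b x y : V) :
  beta_edge X a b -> edge X x y -> eweight X a b <= eweight X x y.
Proof.
case/andP=> ab /eqP->.
have [_ [x1 [y1 [_ [_ [xy1 _ _]]]]]] := cycleX => xy.
exact: le_trans (connectedness_del_le ab xy1) (proj2 xy1 _ _ xy).
Qed.

Lemma min_strong_weightE (a b : V) :
  beta_edge X a b -> min_strong_weight X a = eweight X a b.
Proof.
move=> ab; apply: le_anti; rewrite bigmin_le_cond /=.
  apply: le_bigmin => [|c]; first by have /andP[] := eweight_range X a b.
  by rewrite strong_edgeE; apply: beta_edge_least.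
by rewrite /strong_edge ab orbT.
Qed.

(** * Strong domination in a fuzzy cycle *)

Lemma closed_nbhd_card (a : V) : (#|[set b | (b == a) || edge X a b]| <= 3)%N.
Proof.
have [[c [uc _ _ e]] _] := cycleX.
have /subset_leq_card/leq_trans : [set b | (b == a) || edge X a b] \subset
    [set:: [:: a; next c a; prev c a]].
  apply/subsetP=> b; rewrite !inE e => /or3P[->//|->|/eqP->]; rewrite ?orbT //.
  by rewrite prev_next // eqxx !orbT.
by apply; rewrite cardsE card_size.
Qed.

(** The closed neighbourhoods of the vertices of [D] cover [V], and each has at most three
    elements. *)
Lemma strong_dominating_card (D : {set V}) :
  strong_dominating X D -> (#|V| <= 3 * #|D|)%N.
Proof.
move/forallP=> domD.
have cover b : b \in \bigcup_(a in D) [set b | (b == a) || edge X a b].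
  have [bD|bD] := boolP (b \in D).
    by apply/bigcupP; exists b; rewrite ?inE ?eqxx.
  have := domD b; rewrite bD => /existsP[a /andP[aD ab]].
  by apply/bigcupP; exists a; rewrite // inE -strong_edgeE ab orbT.
rewrite -cardsT mulnC -sum_nat_const.
apply: (@leq_trans (\sum_(a in D) #|[set b | (b == a) || edge X a b]|));
  last by apply: leq_sum => a _; apply: closed_nbhd_card.
have /subset_leq_card/leq_trans : [set: V] \subset
    \bigcup_(a in D) [set b | (b == a) || edge X a b].
  by apply/subsetP=> b _; apply: cover.
apply; elim/big_rec2: _ => [|a k B _ leBk]; first by rewrite cards0.
by rewrite (leq_trans (leq_card_setU _ _)) // leq_add2l.
Qed.

Lemma strong_dominating_exists (u : V) :
  exists D : {set V}, [/\ strong_dominating X D, u \in D &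
    #|D| = ((#|V| + 2) %/ 3)%N].
Proof.
have cX := proj1 cycleX; have n3 := cycle_graph_card cX.
have [pos [inj ltn surj epos] pos_u] := cycle_graph_labelling u cX.
pose D := [set v | 3 %| pos v]%N.
have domD : strong_dominating X D.
  apply/forallP=> b; apply/implyP; rewrite inE => nb3.
  (* Residue 1 is dominated by the predecessor and residue 2 by the successor, except that the last
     vertex is dominated by 0 through the closing edge. *)
  have [i [lti i3 ib]] : exists i, [/\ (i < #|V|)%N, (3 %| i)%N &
      cyclic_adj #|V| i (pos b)].
    have ltb := ltn b; rewrite /cyclic_adj.
    have [b1|b1] := eqVneq (pos b %% 3)%N 1%N.
      by exists (pos b).-1; split; lia.
    have [b2|b2] := eqVneq (pos b).+1 #|V|.
      by exists 0%N; split; lia.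
    by exists (pos b).+1; split; lia.
  have [a pa] := surj i lti.
  by apply/existsP; exists a; rewrite inE pa i3 strong_edgeE epos pa.
exists D; split=> //; first by rewrite inE pos_u.
have le3D := strong_dominating_card domD.
(* The other inequality is [le3D]. For this one, [pos v %/ 3] is injective on the multiples of 3. *)
suff : (#|D| <= (#|V| + 2) %/ 3)%N by lia.
have lt_g v : (pos v %/ 3 < (#|V| + 2) %/ 3)%N by have := ltn v; lia.
pose g v := Ordinal (lt_g v).
have injg : {in D &, injective g}.
  by move=> x y; rewrite !inE => x3 y3 [xy]; apply: inj; lia.
by rewrite -(card_in_imset injg) -[leqRHS]card_ord max_card.
Qed.

Lemma msds_exists (u : V) :
  exists D : {set V}, [/\ minimal_strong_dominating X D, u \in D &
    #|D| = ((#|V| + 2) %/ 3)%N].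
Proof.
have [D [domD uD cardD]] := strong_dominating_exists u.
exists D; split=> //; rewrite /minimal_strong_dominating domD.
(* [D] attains the lower bound, so removing a vertex leaves too few to dominate. *)
apply/forallP=> a; apply/implyP=> aD; apply/negP => /strong_dominating_card.
by have := cardsD1 a D; rewrite aD; lia.
Qed.

Lemma sd_degreeE (w : R) (u : V) :
  0 <= w -> (forall a, min_strong_weight X a = w) ->
  sd_degree X u = w *+ ((#|V| + 2) %/ 3).
Proof.
move=> w0 mw; have weightE S : weight X S = w *+ #|S|.
  by rewrite /weight (eq_bigr (fun=> w)) // sumr_const.
have [D [msD uD cardD]] := msds_exists u.
apply: le_anti; rewrite -{1}cardD -weightE bigmin_le_cond ?msD //=.
(* The default value, the weight of [[set: V]], is bounded below because [D] is a subset and [w] is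
   nonnegative. *)
apply: le_bigmin => [|S /andP[/andP[/strong_dominating_card]]].
  by rewrite weightE ler_wpMn2l // -cardD subset_leq_card ?subsetT.
move=> leS _ _; rewrite weightE ler_wpMn2l //.
have third k : (#|V| <= 3 * k -> (#|V| + 2) %/ 3 <= k)%N by lia.
exact: third leS.
Qed.

End FuzzyCycle.

Lemma ceil_div3 (R : realType) (n : nat) :
  Num.ceil (n%:R / 3%:R : R) = ((n + 2) %/ 3)%N.
Proof.
apply: ceil_def; set m := ((n + 2) %/ 3)%N.
(* These two bounds place [n / 3] above [m - 1] and at most at [m]. *)
have [le1 le2] : (3 * m <= n + 2 /\ n <= 3 * m)%N by rewrite /m; lia.
move: le1 le2; rewrite -(ler_nat R) natrM natrD -(ler_nat R) natrM => le1 le2.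
rewrite rmorphB /= -pmulrn.
by lra.
Qed.

Theorem theorem4p15 (R : realType) (V : finType) (X : fuzzyGraph R V)
    (n : nat) (w : R)
    (card_V : #|V| = n)
    (cycleX : fuzzy_cycle X)
    (saturatedX : beta_saturated X)
    (weight_beta : forall a b : V, beta_edge X a b -> eweight X a b = w) :
  SDI X = n%:R * (Num.ceil (n%:R / 3%:R : R))%:~R * w.
Proof.
have mw a : min_strong_weight X a = w.
  have [b ab] := saturatedX a.
  by rewrite (min_strong_weightE cycleX ab) weight_beta.
(* The sign of [w] is read off a beta-edge, which exists by saturation at some vertex of the
   nonempty [V]. *)
have w0 : 0 <= w.
  have /card_gt0P[a _] := fg_nonempty X; have [b ab] := saturatedX a.
  by rewrite -(weight_beta _ _ ab); have /andP[] := eweight_range X a b.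
rewrite /SDI (eq_bigr (fun=> w *+ ((n + 2) %/ 3))) => [|v _]; last first.
  by rewrite -card_V; apply: sd_degreeE.
by rewrite sumr_const card_V ceil_div3 -pmulrn -mulrA !mulr_natl.
Qed.
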